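(* Let $0<\epsilon\le \tfrac12$. For every finite simple graph $G$ with $n$ vertices and at least one edge, let $E$ be its set of directed edges and $m=|E|$, and suppose $n$ and $m$ are known to the algorithm. Then the algorithm $\texttt{Sample\_edge}(\epsilon)$ (described in the context), run with query access to $G$ in the standard sublinear graph model, has expected running time $O\!\left(\frac{n}{\sqrt m}\log\frac1\epsilon\right)$ (with an absolute implied constant), and the distribution of the edge in $E$ that it returns is pointwise $\epsilon$-close to the uniform distribution on $E$.
   Context: Graph conventions. $G$ is a finite simple undirected graph with vertex set $V$, $|V|=n$. Each undirected edge $\{u,v\}$ is replaced by the two directed edges $(u,v)$ and $(v,u)$; $E$ is the set of directed edges and $m=|E|$ (so $m$ is the sum of the degrees). $d(v)$ is the number of neighbors of $v$. Standard sublinear graph model. The algorithm accesses $G$ only via: uniform random vertex queries (independent uniform samples from $V$), degree queries (given $v$, return $d(v)$), and neighbor queries (given $v$ and $j\ge 1$, return the $j$th neighbor of $v$ in a fixed ordering of its neighbors, or nothing if $j>d(v)$). Each query and each elementary operation, including drawing a uniform random integer from a given range, takes $O(1)$ time. Light and heavy. Let $\theta=\lceil\sqrt{2m}\rceil$. A vertex $v$ is light if $d(v)\le\theta$ and heavy otherwise. Algorithm $\texttt{Sampling\_attempt}(k)$, for an integer $k\ge1$: (1) sample $u_0\in V$ uniformly at random and query $d(u_0)$; (2) if $d(u_0)>\theta$, return fail; (3) choose $j\in\{1,\dots,\theta\}$ uniformly at random; (4) let $u_1$ be the $j$th neighbor of $u_0$, and return fail if there is no such neighbor; (5) for $i=2,\dots,k$: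 if $u_{i-1}$ is light, return fail; otherwise let $u_i$ be a uniformly random neighbor of $u_{i-1}$; (6) return the directed edge $(u_{k-1},u_k)$. Algorithm $\texttt{Sample\_edge}(\epsilon)$: let $\ell=\lceil\log_2\frac1\epsilon\rceil+1$. Repeat independently: pick $k\in\{1,\dots,\ell\}$ uniformly at random and call $\texttt{Sampling\_attempt}(k)$; stop at the first call that does not fail and return its result. Pointwise closeness. A probability distribution $\mathcal P$ is pointwise $\epsilon$-close to $\mathcal Q$ if $|\mathcal P(x)-\mathcal Q(x)|\le\epsilon\,\mathcal Q(x)$ for all $x$. *)

(* Defs.v *)
From HB Require Import structures.
From mathcomp Require Import all_boot all_order all_algebra.
From mathcomp Require Import all_classical all_reals all_analysis.

Set Implicit Arguments.
Unset Strict Implicit.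
Unset Printing Implicit Defensive.

Import Order.TTheory GRing.Theory Num.Theory.
Import numFieldNormedType.Exports.

Local Open Scope ring_scope.

Section Graphs.
Variable V : finType.
Implicit Type e : rel V.

Definition simple_graph e : Prop := symmetric e /\ irreflexive e.

Definition deg e (v : V) : nat := #|[set w | e v w]|.

Definition dedges e : {set V * V} := [set x | e x.1 x.2].

(* [nb v] lists the neighbors of [v] in the fixed order used by the
   neighbor queries. *)
Definition neighbor_ordering e (nb : V -> seq V) : Prop :=
  forall v, uniq (nb v) /\ nb v =i [set w | e v w].

(* Positions are counted from 1, whereas [onth] counts from 0. *)
Definition neighbor (nb : V -> seq V) (v : V) (j : nat) : option V :=
  if j is j'.+1 then onth (nb v) j' else None.

End Graphs.

(* Randomized programs with query access to a graph with vertices in [V].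
   A program is a possibly infinite tree; every node other than [Ret] takes one
   unit of time.  Programs are written for an arbitrary type [V], so they learn
   about the graph only through the answers to their queries. *)
CoInductive prog (V A : Type) : Type :=
| Ret of A
| Elem of prog V A                          (* one elementary operation *)
| RandInt (N : nat) of (nat -> prog V A)    (* uniform on {1, ..., N} *)
| RandVertex of (V -> prog V A)
| DegQuery of V & (nat -> prog V A)
| NeighborQuery of V & nat & (option V -> prog V A).

Arguments Ret {V A} _.
Arguments Elem {V A} _.
Arguments RandInt {V A} _ _.
Arguments RandVertex {V A} _.
Arguments DegQuery {V A} _ _.
Arguments NeighborQuery {V A} _ _ _.

Definition elem_ops (V A : Type) (s : nat) (c : prog V A) : prog V A :=
  iter s Elem c.

(* [retry body c] runs [c] and, whenever a run fails, starts [body] afresh;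
   inspecting the result of a run is one elementary operation. *)
CoFixpoint retry (V A : Type) (body c : prog V (option A)) : prog V A :=
  match c with
  | Ret (Some a) => Elem (Ret a)
  | Ret None => Elem (retry body body)
  | Elem c' => Elem (retry body c')
  | RandInt N k => RandInt N (fun i => retry body (k i))
  | RandVertex k => RandVertex (fun v => retry body (k v))
  | DegQuery v k => DegQuery v (fun d => retry body (k d))
  | NeighborQuery v j k => NeighborQuery v j (fun o => retry body (k o))
  end.

Definition repeat_until_success (V A : Type) (body : prog V (option A)) :
    prog V A :=
  retry body body.

Section Semantics.
Variables (R : realType) (V : finType) (e : rel V) (nb : V -> seq V).
Variable A : finType.
Implicit Type c : prog V A.

(* The probability that [c] halts after exactly [t] units of time and returns
   [x].  Drawing from an empty range never returns: it contributes no mass. *)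
Fixpoint halt_prob (t : nat) c (x : A) {struct t} : R :=
  match t, c with
  | 0%N, Ret a => (a == x)%:R
  | 0%N, _ => 0
  | _.+1, Ret _ => 0
  | t'.+1, Elem c' => halt_prob t' c' x
  | t'.+1, RandInt N k =>
      N%:R^-1 * \sum_(1 <= i < N.+1) halt_prob t' (k i) x
  | t'.+1, RandVertex k =>
      #|V|%:R^-1 * \sum_(v : V) halt_prob t' (k v) x
  | t'.+1, DegQuery v k => halt_prob t' (k (deg e v)) x
  | t'.+1, NeighborQuery v j k => halt_prob t' (k (neighbor nb v j)) x
  end.

Definition time_prob c (t : nat) : R := \sum_(x : A) halt_prob t c x.

Definition output_prob c (x : A) : R :=
  limn (series (fun t => halt_prob t c x)).

(* The last term accounts for the runs that never halt ([+oo * 0 = 0]). *)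
Definition expected_time c : \bar R :=
  (\sum_(0 <= t <oo) (t%:R * time_prob c t)%:E
   + +oo * (1 - \sum_(0 <= t <oo) (time_prob c t)%:E))%E.

End Semantics.

Section Distributions.
Variables (R : realType) (T : finType).

Definition is_distr (P : T -> R) : Prop :=
  (forall x, 0 <= P x) /\ \sum_(x : T) P x = 1.

Definition uniform_on (S : {set T}) (x : T) : R :=
  if x \in S then #|S|%:R^-1 else 0.

Definition pointwise_close (eps : R) (P Q : T -> R) : Prop :=
  forall x, `|P x - Q x| <= eps * Q x.

End Distributions.

Section Algorithm.
Variables (R : realType) (V : Type).

(* The ceilings below are applied to nonnegative reals, so that [absz] only
   converts from [int] to [nat]. *)
Definition theta (m : nat) : nat :=
  `|Num.ceil (Num.sqrt (2 * m%:R : R))|%N.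

Definition num_levels (eps : R) : nat :=
  (`|Num.ceil (ln eps^-1 / ln 2)|%N).+1.

(* The last [s] rounds of the loop of [sampling_attempt], entered with the
   last two visited vertices. *)
Fixpoint heavy_walk (th s : nat) (prev cur : V) : prog V (option (V * V)) :=
  Elem (* loop test *)
  match s with
  | 0%N => Ret (Some (prev, cur))
  | s'.+1 =>
      DegQuery cur (fun d =>
        Elem (* comparison *)
        (if (d <= th)%N then Ret None else
         RandInt d (fun j =>
           NeighborQuery cur j (fun o =>
             if o is Some next then heavy_walk th s' cur next
             else Ret None))))
  end.

Definition sampling_attempt (th k : nat) : prog V (option (V * V)) :=
  RandVertex (fun u0 =>
    DegQuery u0 (fun d =>
      Elem (* comparison *)
      (if (th < d)%N then Ret None else
       RandInt th (fun j =>
         NeighborQuery u0 j (fun o =>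
           Elem (* test whether the neighbor exists *)
           (if o is Some u1 then heavy_walk th k.-1 u0 u1
            else Ret None)))))).

(* Computing the threshold takes three elementary operations (doubling, square
   root, ceiling), and computing the number of levels takes four (inverse,
   binary logarithm, ceiling, increment). *)
Definition sample_edge (m : nat) (eps : R) : prog V (V * V) :=
  elem_ops 3 (elem_ops 4
    (repeat_until_success
      (RandInt (num_levels eps) (fun k => sampling_attempt (theta m) k)))).

End Algorithm.

(* Main.v *)
(* An attempt with k + 1 steps returns an edge (u, v) with probability
   reach_k(u) / (n theta), where reach_0 is the indicator of the light vertices
   and reach_(k+1)(u) is, for heavy u, the average of reach_k over the neighbors
   of u.  By reversibility reach_k(u) is the probability that the random walk
   from u first meets a light vertex after exactly k steps; as there are at most
   theta / 2 heavy vertices, a heavy vertex has at least as many light neighbors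
   as heavy ones, so that 1 - sum_(i <= k) reach_i(u) <= 2^-k, and a walk lasts
   O(1) steps on average.  For the upper bound on the output probabilities one
   also uses that at most two thirds of the directed edges start at a heavy
   vertex, so that at most 2/3 eps m of the mass is lost.

   The repetition of a finite program is analysed with functionals F of programs
   satisfying F c <= tau + (mean of F after one step of c): the running time
   truncated at n (tau = 1) and the probability of having returned x by time n
   (tau = 0).  This yields upper bounds only; bounded truncated times force
   almost sure halting, and then the bounds on the output probabilities, which
   sum up to 1, are attained. *)
Require Import Defs.
From HB Require Import structures.
From mathcomp Require Import all_boot all_order all_algebra.
From mathcomp Require Import all_classical all_reals all_analysis.
From mathcomp Require Import ring lra.

Set Implicit Arguments.
Unset Strict Implicit.
Unset Printing Implicit Defensive.

Import Order.TTheory GRing.Theory Num.Theory.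
Import numFieldNormedType.Exports.

Local Open Scope ring_scope.

(** * Unfolding the retry loop *)

Section Retry.
Variables (V A : Type).

(** A cofixpoint reduces only under a [match]; this identity exposes one step of [retry]. *)
Lemma prog_eta (B : Type) (c : prog V B) :
  c = match c with
      | Ret a => Ret a
      | Elem c' => Elem c'
      | RandInt N k => RandInt N k
      | RandVertex k => RandVertex k
      | DegQuery v k => DegQuery v k
      | NeighborQuery v j k => NeighborQuery v j k
      end.
Proof. by case: c. Qed.

Lemma retryE (body c : prog V (option A)) :
  retry body c =
  match c with
  | Ret (Some a) => Elem (Ret a)
  | Ret None => Elem (retry body body)
  | Elem c' => Elem (retry body c')
  | RandInt N k => RandInt N (fun i => retry body (k i))
  | RandVertex k => RandVertex (fun v => retry body (k v))
  | DegQuery v k => DegQuery v (fun d => retry body (k d))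
  | NeighborQuery v j k => NeighborQuery v j (fun o => retry body (k o))
  end.
Proof. by rewrite [LHS]prog_eta; case: c => //= -[]. Qed.

End Retry.

(** * Averages over one step of a program *)

Section Mean.
Variable R : realFieldType.

Lemma mean_const (I : Type) (r : seq I) (a : R) :
  (0 < size r)%N -> (size r)%:R^-1 * (\sum_(i <- r) a) = a.
Proof.
move=> r_gt0; rewrite big_const_seq count_predT iter_addr_0.
by rewrite -[X in _ * X]mulr_natl mulKf// pnatr_eq0 -lt0n.
Qed.

End Mean.

Section OneStep.
Variables (R : realType) (V : finType) (e : rel V) (nb : V -> seq V).
Variable A : Type.
Implicit Types (c : prog V A) (h : prog V A -> R).

Definition mean_next c h : R :=
  match c with
  | Ret _ => 0
  | Elem c' => h c'
  | RandInt N k => N%:R^-1 * \sum_(1 <= i < N.+1) h (k i)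
  | RandVertex k => #|V|%:R^-1 * \sum_(v : V) h (k v)
  | DegQuery v k => h (k (deg e v))
  | NeighborQuery v j k => h (k (neighbor nb v j))
  end.

(** Singles out the nodes where [mean_next] preserves constants: it vanishes at [Ret], and at an
    empty draw because the inverse of 0 is 0. *)
Definition productive c : bool :=
  match c with
  | Ret _ => false
  | RandInt N _ => (0 < N)%N
  | RandVertex _ => (0 < #|V|)%N
  | _ => true
  end.

Definition is_ret c : bool := if c is Ret _ then true else false.

Lemma productive_is_ret c : productive c -> ~~ is_ret c.
Proof. by case: c. Qed.

Lemma mean_next_sum (I : Type) (r : seq I) (P : pred I)
    (h : I -> prog V A -> R) c :
  mean_next c (fun c' => \sum_(i <- r | P i) h i c') =
  \sum_(i <- r | P i) mean_next c (h i).
Proof.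
case: c => //= [a|N k|k]; first by rewrite big1.
  by rewrite exchange_big/= mulr_sumr.
by rewrite exchange_big/= mulr_sumr.
Qed.

Lemma le_mean_next h1 h2 c :
  (forall c', h1 c' <= h2 c') -> mean_next c h1 <= mean_next c h2.
Proof.
move=> h12; case: c => //= [N k|k].
  by apply: ler_wpM2l; [rewrite invr_ge0 ler0n|apply: ler_sum].
by apply: ler_wpM2l; [rewrite invr_ge0 ler0n|apply: ler_sum].
Qed.

Lemma mean_next0 c : mean_next c (fun=> 0) = 0.
Proof. by case: c => //= [N k|k]; rewrite big1// mulr0. Qed.

Lemma mean_next_const (a : R) c : productive c -> mean_next c (fun=> a) = a.
Proof.
case: c => //= [N k N0|k V0].
  have := @mean_const R _ (index_iota 1 N.+1) a.
  by rewrite size_iota subSS subn0; exact.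
have := @mean_const R _ (index_enum V) a.
by rewrite -[index_enum V]enumT -cardE big_enum; exact.
Qed.

Lemma mean_next_le1 h c : (forall c', h c' <= 1) -> mean_next c h <= 1.
Proof.
move=> h1; have [pc|] := boolP (productive c).
  by rewrite -[leRHS](mean_next_const 1 pc) le_mean_next.
case: c => //= [N k|k].
  by rewrite -eqn0Ngt => /eqP->; rewrite invr0 mul0r ler01.
by rewrite -eqn0Ngt => /eqP->; rewrite invr0 mul0r ler01.
Qed.

Lemma mean_next_ge0 h c : (forall c', 0 <= h c') -> 0 <= mean_next c h.
Proof. by move=> /(@le_mean_next (fun=> 0)) -/(_ c); rewrite mean_next0. Qed.

Lemma mean_nextB h1 h2 c :
  mean_next c (fun c' => h1 c' - h2 c') = mean_next c h1 - mean_next c h2.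
Proof.
case: c => //= [a|N k|k]; first by rewrite subr0.
  by rewrite big_split/= mulrDr sumrN mulrN.
by rewrite big_split/= mulrDr sumrN mulrN.
Qed.

End OneStep.

(** * Programs that halt in bounded time, and their repetition *)

Section Runs.
Variables (R : realType) (V : finType) (e : rel V) (nb : V -> seq V).
Variable A : Type.

(* [runs c Q t]: the program [c] halts in bounded time, the expectation of [f]
   at its output is [Q f], and its expected running time is at most [t]. *)
Inductive runs : prog V A -> ((A -> R) -> R) -> R -> Prop :=
| runs_ret a : runs (Ret a) (fun f => f a) 0
| runs_elem c Q t : runs c Q t -> runs (Elem c) Q (1 + t)
| runs_int N k Q t : (0 < N)%N ->
    (forall i, (0 < i <= N)%N -> runs (k i) (Q i) (t i)) ->
    runs (RandInt N k) (fun f => N%:R^-1 * \sum_(1 <= i < N.+1) Q i f)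
      (1 + N%:R^-1 * \sum_(1 <= i < N.+1) t i)
| runs_vertex k Q t : (0 < #|V|)%N -> (forall v, runs (k v) (Q v) (t v)) ->
    runs (RandVertex k) (fun f => #|V|%:R^-1 * \sum_(v : V) Q v f)
      (1 + #|V|%:R^-1 * \sum_(v : V) t v)
| runs_deg v k Q t : runs (k (deg e v)) Q t -> runs (DegQuery v k) Q (1 + t)
| runs_neighbor v j k Q t : runs (k (neighbor nb v j)) Q t ->
    runs (NeighborQuery v j k) Q (1 + t)
| runs_weaken c Q Q' t t' : runs c Q t -> Q =1 Q' -> t <= t' -> runs c Q' t'.

End Runs.

Section RetryBound.
Variables (R : realType) (V : finType) (e : rel V) (nb : V -> seq V).
Variable A : Type.
Variables (F : prog V A -> R) (tau : R).
Hypothesis tau_ge0 : 0 <= tau.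
Hypothesis F_next : forall c, productive c -> F c <= tau + mean_next e nb c F.

(** Induction on [runs], each node costing one [tau]. The [tau] under [Q] pays for the [Elem] node
    by which [retry] inspects a result. *)
Lemma retry_bound body c Q t : runs e nb c Q t ->
  F (retry body c) <=
    tau * t + Q (fun o => tau + if o is Some a then F (Ret a)
                                else F (retry body body)).
Proof.
elim=> {c Q t}.
- move=> a; rewrite mulr0 add0r retryE.
  by case: a => [a|]; apply: (le_trans (F_next _)).
- move=> c Q t _ IH; rewrite retryE (le_trans (F_next _))//=.
  by rewrite mulrDr mulr1 -addrA lerD2l.
- move=> N k Q t N0 _ IH; rewrite retryE (le_trans (F_next _))//=.
  rewrite mulrDr mulr1 -addrA lerD2l mulrCA -mulrDr ler_wpM2l ?invr_ge0//.
  by rewrite mulr_sumr -big_split/= big_nat [leRHS]big_nat ler_sum.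
- move=> k Q t V0 _ IH; rewrite retryE (le_trans (F_next _))//=.
  rewrite mulrDr mulr1 -addrA lerD2l mulrCA -mulrDr ler_wpM2l ?invr_ge0//.
  by rewrite mulr_sumr -big_split/= ler_sum.
- move=> v k Q t _ IH; rewrite retryE (le_trans (F_next _))//=.
  by rewrite mulrDr mulr1 -addrA lerD2l.
- move=> v j k Q t _ IH; rewrite retryE (le_trans (F_next _))//=.
  by rewrite mulrDr mulr1 -addrA lerD2l.
- move=> c Q Q' t t' _ IH QQ' tt'; rewrite (le_trans IH)// QQ' lerD2r.
  exact: ler_wpM2l.
Qed.

End RetryBound.

(** * Halting probabilities and truncated running times *)

Section HaltingTime.
Variables (R : realType) (V : finType) (e : rel V) (nb : V -> seq V).
Variable A : finType.
Implicit Type c : prog V A.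
Local Notation halt := (halt_prob R e nb).
Local Notation mean_next := (mean_next e nb).

Lemma halt_probS t c x : halt t.+1 c x = mean_next c (fun c' => halt t c' x).
Proof. by case: c. Qed.

Lemma halt_prob_ge0 t c x : 0 <= halt t c x.
Proof.
elim: t c => [|t IH] c; first by case: c => //= a; rewrite ler0n.
by rewrite halt_probS mean_next_ge0.
Qed.

Definition out_by n c (x : A) : R := \sum_(0 <= t < n) halt t c x.

Definition halted_by n c : R := \sum_(0 <= t < n) time_prob R e nb c t.

Lemma halted_byE n c : halted_by n c = \sum_x out_by n c x.
Proof. exact: exchange_big. Qed.

Lemma time_prob_ge0 c t : 0 <= time_prob R e nb c t.
Proof. by apply: sumr_ge0 => x _; exact: halt_prob_ge0. Qed.

Lemma out_by_Ret n (a x : A) : out_by n (Ret a) x <= (a == x)%:R.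
Proof.
case: n => [|n]; first by rewrite /out_by big_geq// ler0n.
by rewrite /out_by big_nat_recl//= big1 ?addr0.
Qed.

Lemma out_by_next n c x :
  ~~ is_ret c -> out_by n.+1 c x = mean_next c (out_by n ^~ x).
Proof.
move=> pc; rewrite /out_by big_nat_recl// mean_next_sum.
under eq_bigr do rewrite halt_probS.
by case: c pc => //= *; rewrite add0r.
Qed.

Lemma halted_by_Ret n (a : A) : halted_by n.+1 (Ret a) = 1.
Proof.
rewrite /halted_by big_nat_recl//= [X in _ + X]big1 ?addr0.
  by rewrite /time_prob/= (bigD1 a)//= eqxx big1 ?addr0// => x /negPf;
    rewrite eq_sym => ->.
by move=> t _; rewrite /time_prob big1.
Qed.

Lemma halted_by_next n c :
  ~~ is_ret c -> halted_by n.+1 c = mean_next c (halted_by n).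
Proof.
move=> pc; rewrite halted_byE; under eq_bigr do rewrite out_by_next//.
by rewrite -mean_next_sum; congr mean_next; apply/funext => c';
  rewrite halted_byE.
Qed.

Lemma halted_by_le1 n c : halted_by n c <= 1.
Proof.
elim: n c => [|n IH] c; first by rewrite /halted_by big_geq.
have [|pc] := boolP (is_ret c); first by case: c => // a; rewrite halted_by_Ret.
by rewrite halted_by_next// mean_next_le1.
Qed.

Lemma halted_byS n c :
  halted_by n.+1 c = halted_by n c + time_prob R e nb c n.
Proof. exact: big_nat_recr. Qed.

(** The expectation of min(T, n) for the halting time T, as the sum of the tails P(T > t). *)
Definition truncated_time n c : R := \sum_(0 <= t < n) (1 - halted_by t.+1 c).

Lemma truncated_timeS n c :
  truncated_time n.+1 c = truncated_time n c + (1 - halted_by n.+1 c).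
Proof. exact: big_nat_recr. Qed.

Lemma truncated_time_Ret n (a : A) : truncated_time n (Ret a) = 0.
Proof. by apply: big1 => t _; rewrite halted_by_Ret subrr. Qed.

(** With T' the time left after one step, min(T, n) <= min(T, n + 1) = 1 + min(T', n). *)
Lemma truncated_time_le_next n c :
  productive c -> truncated_time n c <= 1 + mean_next c (truncated_time n).
Proof.
move=> pc; have rc := productive_is_ret pc.
apply: (@le_trans _ _ (truncated_time n.+1 c)).
  by rewrite truncated_timeS lerDl subr_ge0 halted_by_le1.
rewrite /truncated_time big_nat_recl// lerD//.
  rewrite lerBlDr lerDl halted_by_next//; apply: mean_next_ge0 => c'.
  by rewrite /halted_by big_geq.
rewrite mean_next_sum ler_sum// => t _.
by rewrite mean_nextB mean_next_const// halted_by_next.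
Qed.

Lemma out_by_le_next n c x :
  productive c -> out_by n c x <= mean_next c (out_by n ^~ x).
Proof.
move=> /productive_is_ret rc; rewrite -out_by_next//.
by rewrite /out_by [leRHS]big_nat_recr//= lerDl halt_prob_ge0.
Qed.

Lemma truncated_timeE n c :
  \sum_(0 <= t < n) t%:R * time_prob R e nb c t + n%:R * (1 - halted_by n c) =
  truncated_time n c.
Proof.
elim: n => [|n IH]; first by rewrite /truncated_time !big_geq// mul0r addr0.
rewrite truncated_timeS -IH big_nat_recr//= halted_byS -natr1; ring.
Qed.

Section Bounded.
Variables (c : prog V A) (B : R).
Hypothesis time_le : forall n, truncated_time n c <= B.

(** Markov's inequality: n P(T >= n) is at most the truncated time, hence at most [B]. *)
Lemma halted_by_cvg : (halted_by n c @[n --> \oo] --> (1 : R))%classic.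
Proof.
(* After the shift the denominator is n + 1, never 0, with inverse [harmonic n]. *)
rewrite -(cvg_shiftS (fun n => halted_by n c)) /=.
apply: (@squeeze_cvgr _ _ _ _ (fun n => 1 - B * harmonic n) (fun=> 1)).
- near=> n; rewrite halted_by_le1 andbT lerBlDl -lerBlDr.
  rewrite -(ler_pM2r (ltr0Sn R n)) -mulrA mulVf ?mulr1 ?pnatr_eq0// mulrC.
  apply: le_trans (time_le n.+1); rewrite -truncated_timeE lerDr.
  by apply: sumr_ge0 => t _; rewrite mulr_ge0// time_prob_ge0.
- rewrite -[X in (_ --> X)%classic](subr0 1) -(mulr0 B).
  apply: cvgB; first exact: cvg_cst.
  by apply: cvgM; [exact: cvg_cst|exact: cvg_harmonic].
- exact: cvg_cst.
Unshelve. all: by end_near. Qed.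

Lemma expected_time_le : (expected_time R e nb c <= B%:E)%E.
Proof.
rewrite /expected_time.
have -> : (\sum_(0 <= t <oo) (time_prob R e nb c t)%:E = 1)%E.
  apply: cvg_lim => //.
  rewrite (_ : (fun n => _) = EFin \o halted_by ^~ c); last first.
    by apply/funext => n /=; rewrite sumEFin.
  by apply: cvg_EFin; [near=> n|exact: halted_by_cvg].
rewrite subee// mule0 adde0; apply: lime_le.
  by apply: is_cvg_nneseries => t _ _; rewrite lee_fin mulr_ge0// time_prob_ge0.
near=> n; rewrite sumEFin lee_fin (le_trans _ (time_le n))// -truncated_timeE.
by rewrite lerDl mulr_ge0// subr_ge0 halted_by_le1.
Unshelve. all: by end_near. Qed.

(* The bounds [y x] sum up to the total probability of halting, so none of them
   can be strict. *)
Lemma output_probE (y : A -> R) : (forall n x, out_by n c x <= y x) ->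
  \sum_x y x = 1 -> output_prob R e nb c =1 y.
Proof.
move=> out_le y1 x.
have out_ge n : y x - (1 - halted_by n c) <= out_by n c x.
  have others : \sum_(i | i != x) out_by n c i <= \sum_(i | i != x) y i.
    by apply: ler_sum.
  have := halted_byE n c; rewrite (bigD1 x)//= => ->.
  by move: y1; rewrite (bigD1 x)//= => <-; lra.
apply: cvg_lim => //.
apply: (@squeeze_cvgr _ _ _ _ (fun n => y x - (1 - halted_by n c)) (fun=> y x)).
- by near=> n; apply/andP; split; [exact: out_ge|exact: out_le].
- rewrite -[X in (_ --> X)%classic]subr0 -(subrr 1).
  apply: cvgB; first exact: cvg_cst.
  by apply: cvgB; [exact: cvg_cst|exact: halted_by_cvg].
- exact: cvg_cst.
Unshelve. all: by end_near. Qed.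

End Bounded.

End HaltingTime.

(** * Repeating an attempt until it succeeds *)

Section RepeatUntilSuccess.
Variables (R : realType) (V : finType) (e : rel V) (nb : V -> seq V).
Variable A : finType.
Variables (body : prog V (option A)) (p : A -> R) (t : R).
Hypothesis body_runs :
  runs e nb body (fun f => f None + \sum_x p x * (f (Some x) - f None)) t.
Hypothesis p_ge0 : forall x, 0 <= p x.
Hypothesis p_gt0 : 0 < \sum_x p x.

(** With T the truncated time and S the sum of [p], [retry_bound] gives T <= t + 1 + (1 - S) T. As T
    is finite, it can be moved to the left. *)
Lemma truncated_time_repeat n :
  truncated_time R e nb n (repeat_until_success body) <= (t + 1) / \sum_x p x.
Proof.
rewrite ler_pdivlMr//; have := retry_bound ler01
  (@truncated_time_le_next R V e nb A n) body body_runs.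
rewrite -/(repeat_until_success body) mul1r.
set T := truncated_time _ _ _ _ _; under eq_bigr => x _ do
  rewrite truncated_time_Ret addr0 opprD addNKr mulrN.
rewrite sumrN -mulr_suml; lra.
Qed.

(** A failed run starts afresh, so the probability o satisfies o <= p x + (1 - S) o, with S the sum
    of [p]. *)
Lemma out_by_repeat n x :
  out_by R e nb n (repeat_until_success body) x <= p x / \sum_y p y.
Proof.
have F_next c : productive c ->
    out_by R e nb n c x <=
    0 + mean_next e nb c (fun c' => out_by R e nb n c' x).
  by rewrite add0r; exact: out_by_le_next.
rewrite ler_pdivlMr//; have := retry_bound (lexx 0) F_next body body_runs.
rewrite -/(repeat_until_success body) mul0r !add0r.
set o := out_by _ _ _ _ _ _; under eq_bigr => y _ do rewrite !add0r mulrBr.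
rewrite big_split/= sumrN -mulr_suml.
suff : \sum_y p y * out_by R e nb n (Ret y) x <= p x by lra.
apply: (@le_trans _ _ (\sum_y p y * (y == x)%:R)).
  by apply: ler_sum => y _; rewrite ler_wpM2l// out_by_Ret.
by rewrite (bigD1 x)//= eqxx mulr1 big1 ?addr0// => y /negPf->; rewrite mulr0.
Qed.

Lemma truncated_time_elem_ops n s (c : prog V A) :
  truncated_time R e nb n (elem_ops s c) <= s%:R + truncated_time R e nb n c.
Proof.
elim: s => [|s IH]; first by rewrite add0r.
rewrite (le_trans (@truncated_time_le_next _ _ _ _ _ _ (Elem _) _))//=.
by rewrite -natr1 addrAC [leRHS]addrC lerD2l.
Qed.

Lemma out_by_elem_ops n s (c : prog V A) x :
  out_by R e nb n (elem_ops s c) x <= out_by R e nb n c x.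
Proof.
elim: s => [//|s IH]; apply: le_trans IH.
exact: (@out_by_le_next _ _ _ _ _ _ (Elem _)).
Qed.

Lemma repeat_until_successP s :
  let c := elem_ops s (repeat_until_success body) in
  (expected_time R e nb c <= (s%:R + (t + 1) / \sum_x p x)%:E)%E /\
  output_prob R e nb c =1 (fun x => p x / \sum_y p y).
Proof.
move=> c; have time_le n :
    truncated_time R e nb n c <= s%:R + (t + 1) / \sum_x p x.
  apply: (le_trans (truncated_time_elem_ops _ _ _)).
  by rewrite lerD2l truncated_time_repeat.
split; first exact: expected_time_le time_le.
apply: (output_probE time_le) => [n x|].
  by apply: le_trans (out_by_repeat n x); exact: out_by_elem_ops.
by rewrite -mulr_suml mulfV// gt_eqF.
Qed.

End RepeatUntilSuccess.

(** * Heavy vertices, walks and the law of one attempt *)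

Section Graph.
Variables (R : realType) (V : finType) (e : rel V) (nb : V -> seq V).
Hypotheses (e_sym : symmetric e) (nbP : neighbor_ordering e nb).
Variable th : nat.
Hypotheses (th_gt0 : (0 < th)%N) (th_ge : (2 * #|dedges e| <= th ^ 2)%N).

Definition heavy v : bool := (th < deg e v)%N.

Lemma deg_gt0 v : heavy v -> (0 < deg e v)%N.
Proof. exact: leq_ltn_trans. Qed.

Lemma size_nb v : size (nb v) = deg e v.
Proof. by have [u nbE] := nbP v; rewrite -(card_uniqP u) (eq_card nbE). Qed.

(** Each neighbor occupies exactly one position, and the positions beyond the degree answer
    [None]. *)
Lemma sum_neighbor (g : option V -> R) v N : (deg e v <= N)%N ->
  \sum_(1 <= j < N.+1) g (neighbor nb v j) =
  N%:R * g None + \sum_(w | e v w) (g (Some w) - g None).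
Proof.
move=> vN; rewrite big_add1/=.
under eq_bigr => j _ do rewrite -(subrKC (g None) (g (onth _ _))).
rewrite big_split/= big_const_nat iter_addr_0 subn0.
rewrite -[in LHS]mulr_natl; congr (_ + _).
rewrite (@big_cat_nat _ _ _ (deg e v))//=.
rewrite [X in _ + X]big_nat_cond [X in _ + X]big1 ?addr0.
  transitivity (\sum_(w <- nb v) (g (Some w) - g None)).
    rewrite (big_nth v) size_nb big_nat [RHS]big_nat.
    apply: eq_bigr => i /andP[_ iv].
    by rewrite onthE (nth_map v) ?size_nb.
  have [u nbE] := nbP v; rewrite big_uniq//=.
  by apply: eq_bigl => w; rewrite nbE inE.
move=> j /andP[/andP[vj _] _].
by rewrite onth_default ?size_nb// subrr.
Qed.

Lemma sum_edge_const (f : V -> R) :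
  \sum_u \sum_(v | e u v) f u = \sum_u (deg e u)%:R * f u.
Proof.
apply: eq_bigr => u _; rewrite big_const iter_addr_0 -[in LHS]mulr_natl.
by rewrite /deg cardsE.
Qed.

Lemma card_dedges : (#|dedges e| = \sum_v deg e v)%N.
Proof.
rewrite -sum1_card (eq_bigl (fun x : V * V => e x.1 x.2)); last first.
  by move=> x; rewrite inE.
rewrite -(pair_big_dep predT (fun u v => e u v) (fun _ _ => 1%N))/=.
by apply: eq_bigr => u _; rewrite sum1_card /deg cardsE.
Qed.

(** If there are h heavy vertices, h th is at most the sum of the degrees, hence at most th^2 / 2;
    so 2 h <= th < [deg e v]. *)
Lemma half_neighbors_heavy v : heavy v ->
  \sum_(w | e v w) (heavy w)%:R <= 2^-1 * (deg e v)%:R :> R.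
Proof.
move=> hv; rewrite ler_pdivlMl// -natr_sum -natrM ler_nat.
apply: leq_trans (ltnW hv).
rewrite -(leq_pmul2r th_gt0) mulnn (leq_trans _ th_ge)// -mulnA leq_mul2l/=.
rewrite card_dedges (@leq_trans ((\sum_w heavy w) * th)%N)//.
  rewrite leq_mul2r [leqRHS](bigID (e v))/= leq_addr orbT//.
rewrite big_distrl /= leq_sum// => w _; rewrite /heavy.
by case: ltnP => [dw|_]; rewrite ?mul1n ?mul0n ?(ltnW dw).
Qed.

(** The expectation of [g] at the edge returned by the last [s] rounds, a failed walk counting 0. *)
Fixpoint walk s (u v : V) (g : V * V -> R) : R :=
  match s with
  | 0%N => g (u, v)
  | s'.+1 =>
      (heavy v)%:R / (deg e v)%:R * \sum_(w | e v w) walk s' v w g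
  end.

(** A light vertex costs at most 3 operations. A heavy one costs 5, and the next vertex is heavy
    with probability at most 1/2, so the total is at most 5 + 3 + 10 / 2 = 3 + 10, whatever [s]
    is. *)
Lemma heavy_walk_runs s u v :
  runs e nb (heavy_walk th s u v)
    (fun f => f None + walk s u v (fun x => f (Some x) - f None))
    (3 + 10 * (heavy v)%:R).
Proof.
elim: s u v => [|s IH] u v /=.
  apply: (runs_weaken (runs_elem (runs_ret _ _ _ _))) => [f|].
    by rewrite subrKC.
  by have := ler0n R (heavy v); lra.
rewrite -/(heavy v).
have [hv|lv] := boolP (heavy v); last first.
  apply: runs_weaken.
  - apply/runs_elem/runs_deg/runs_elem; rewrite leqNgt -/(heavy v) lv.
    exact: runs_ret.
  - by move=> f /=; rewrite !mul0r addr0.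
  - by rewrite mulr0; lra.
pose q o f : R := if o is Some w
  then f None + walk s v w (fun x => f (Some x) - f None) else f None.
pose r o : R := 1 + if o is Some w then 3 + 10 * (heavy w)%:R else 0.
apply: runs_weaken.
- apply/runs_elem/runs_deg/runs_elem; rewrite leqNgt -/(heavy v) hv/=.
  apply: (@runs_int _ _ _ _ _ _ _ (fun j => q (neighbor nb v j))
    (fun j => r (neighbor nb v j))); first exact: deg_gt0.
  move=> j _; apply: runs_neighbor; rewrite /q.
  by case: (neighbor nb v j) => [w|]; [exact: IH|exact: runs_ret].
- move=> f /=; rewrite (sum_neighbor (q ^~ f))//=.
  rewrite mulrDr mulKf ?pnatr_eq0 -?lt0n ?deg_gt0// mul1r.
  by congr (_ + _ * _); apply: eq_bigr => w _; rewrite addrC addKr.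
- have dv : 0 < (deg e v)%:R :> R by rewrite ltr0n deg_gt0.
  rewrite (sum_neighbor r)//= /r mulrDr mulKf ?gt_eqF//.
  rewrite (eq_bigr (fun w => 3 + 10 * (heavy w)%:R)); last by move=> w _; ring.
  rewrite big_split/= big_const iter_addr_0 -mulr_sumr.
  have : (deg e v)%:R^-1 * \sum_(w | e v w) (heavy w)%:R <= 2^-1 :> R.
    by rewrite mulrC ler_pdivrMr// half_neighbors_heavy.
  rewrite mulrDr -[3 *+ _]mulr_natl /deg cardsE mulKf; last first.
    by move: dv; rewrite /deg cardsE => /gt_eqF->.
  rewrite mulrCA; lra.
Qed.

(** Six operations precede the loop, which costs at most 13. *)
Lemma sampling_attempt_runs k : (0 < #|V|)%N ->
  runs e nb (sampling_attempt V th k)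
    (fun f => f None + (#|V|%:R * th%:R)^-1 *
       \sum_u (~~ heavy u)%:R * \sum_(v | e u v)
         walk k.-1 u v (fun x => f (Some x) - f None))
    19.
Proof.
move=> V0.
pose q u o f : R := if o is Some v
  then f None + walk k.-1 u v (fun x => f (Some x) - f None) else f None.
pose Q u f : R := f None + (~~ heavy u)%:R * (th%:R^-1 * \sum_(v | e u v)
  walk k.-1 u v (fun x => f (Some x) - f None)).
have thR : th%:R != 0 :> R by rewrite pnatr_eq0 -lt0n.
have VR : #|V|%:R != 0 :> R by rewrite pnatr_eq0 -lt0n.
apply: runs_weaken.
- apply: (@runs_vertex _ _ _ _ _ _ Q (fun=> 18)) => // u.
  apply: (@runs_weaken _ _ _ _ _ _ (Q u) _ (1 + (1 + 16))) => //.
  apply/runs_deg/runs_elem; rewrite -/(heavy u).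
  have [hu|lu] := boolP (heavy u).
    apply: (runs_weaken (runs_ret _ _ _ _)) => [f|]; last lra.
    by rewrite /Q hu mul0r addr0.
  apply: runs_weaken.
  + apply: (@runs_int _ _ _ _ _ _ _ (fun j => q u (neighbor nb u j))
      (fun=> 15)) => // j _.
    apply: (@runs_weaken _ _ _ _ _ _ (q u (neighbor nb u j)) _ (1 + (1 + 13)))
      => //.
    apply/runs_neighbor/runs_elem; rewrite /q.
    case: (neighbor nb u j) => [v|].
      apply: (runs_weaken (heavy_walk_runs _ _ _)) => //.
      by have := lern1 R (heavy v); rewrite leq_b1; lra.
    by apply: (runs_weaken (runs_ret _ _ _ _)) => //; lra.
  + move=> f /=; rewrite (sum_neighbor (q u ^~ f)) 1?leqNgt//= mulrDr mulKf//.
    rewrite /Q lu mul1r; congr (_ + _ * _).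
    by apply: eq_bigr => v _; rewrite addrC addKr.
  + rewrite big_const_nat iter_addr_0 subSS subn0 -[15 *+ _]mulr_natl.
    by rewrite mulKf.
- move=> f /=; rewrite big_split/= big_const iter_addr_0.
  rewrite -[f None *+ _]mulr_natl.
  rewrite mulrDr mulKf// invfM -mulrA; congr (_ + _ * _).
  by rewrite mulr_sumr; apply: eq_bigr => u _; rewrite mulrCA.
- by rewrite big_const iter_addr_0 -[18 *+ _]mulr_natl mulKf.
Qed.

(* [reach k v / (n theta)] is the probability that an attempt with [k.+1] steps
   returns [(v, w)], for any neighbor [w] of [v]. *)
Fixpoint reach k (v : V) : R :=
  match k with
  | 0%N => (~~ heavy v)%:R
  | k'.+1 => (heavy v)%:R / (deg e v)%:R * \sum_(u | e v u) reach k' u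
  end.

Lemma exchange_edges (f : V -> V -> R) :
  \sum_u \sum_(v | e u v) f u v = \sum_v \sum_(u | e v u) f u v.
Proof.
rewrite (exchange_big_dep predT)//=; apply: eq_bigr => v _.
by apply: eq_bigl => u; exact: e_sym.
Qed.

(** Reversing the edges moves one averaging step at the second vertex from [walk] into [reach]. *)
Lemma walk_reach s k g :
  \sum_u reach k u * \sum_(v | e u v) walk s u v g =
  \sum_u \sum_(v | e u v) reach (k + s) u * g (u, v).
Proof.
elim: s k => [|s IH] k.
  by apply: eq_bigr => u _; rewrite addn0 mulr_sumr.
rewrite addnS -addSn -IH; under eq_bigr do rewrite mulr_sumr.
rewrite exchange_edges; apply: eq_bigr => v _ /=.
by rewrite -mulr_suml mulrA; congr (_ * _); exact: mulrC.
Qed.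

Definition unreached k v : R := 1 - \sum_(i < k.+1) reach i v.

(** At a light [v], [reach 0 v] is already 1. At a heavy [v], 1 is its own average over the
    neighbors, so the subtraction passes inside. *)
Lemma unreachedS k v : unreached k.+1 v =
  (heavy v)%:R / (deg e v)%:R * \sum_(u | e v u) unreached k u.
Proof.
have reachE : \sum_(i < k.+1) reach i.+1 v =
    (heavy v)%:R / (deg e v)%:R * \sum_(u | e v u) \sum_(i < k.+1) reach i u.
  by rewrite exchange_big mulr_sumr.
rewrite /unreached big_ord_recl reachE sumrB [reach _ v]/=.
have [hv|_] := boolP (heavy v); last by rewrite !mul0r addr0 subrr.
rewrite add0r !mul1r mulrBr sumr_const /deg cardsE mulVf// pnatr_eq0 -lt0n.
by have := deg_gt0 hv; rewrite /deg cardsE.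
Qed.

Lemma unreached_bound k v : 0 <= unreached k v <= (heavy v)%:R * 2^-1 ^+ k.
Proof.
elim: k v => [|k IH] v.
  rewrite /unreached big_ord1/= mulr1.
  by case: (heavy v); rewrite ?subr0 ?subrr lexx ?ler01.
rewrite unreachedS; have [hv|_] := boolP (heavy v); last by rewrite !mul0r lexx.
have dv : 0 < (deg e v)%:R :> R by rewrite ltr0n deg_gt0.
rewrite !mul1r mulr_ge0 ?invr_ge0 ?(ltW dv)//=; last first.
  by apply: sumr_ge0 => u _; case/andP: (IH u).
rewrite mulrC ler_pdivrMr//.
apply: (@le_trans _ _ (\sum_(u | e v u) (heavy u)%:R * 2^-1 ^+ k)).
  by apply: ler_sum => u _; case/andP: (IH u).
rewrite -mulr_suml exprS -mulrA mulrCA mulrC ler_wpM2l ?exprn_ge0 ?invr_ge0//.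
exact: half_neighbors_heavy.
Qed.

(** Let H edges leave heavy vertices. At most H / 2 of them end at heavy vertices, so at least H / 2
    end at light ones; reversed, these are among the edges leaving light vertices. *)
Lemma heavy_edges_le :
  3 * (\sum_u (deg e u)%:R * (heavy u)%:R) <= 2 * #|dedges e|%:R :> R.
Proof.
have hl : \sum_u \sum_(v | e u v) (heavy u)%:R * (heavy v)%:R <=
    2^-1 * \sum_u (deg e u)%:R * (heavy u)%:R :> R.
  rewrite mulr_sumr ler_sum// => u _; rewrite -mulr_sumr.
  have [hu|_] := boolP (heavy u); last by rewrite mul0r !mulr0.
  by rewrite mul1r mulr1 half_neighbors_heavy.
have light : \sum_u \sum_(v | e u v) (heavy u)%:R * (~~ heavy v)%:R <=
    \sum_u (deg e u)%:R * (~~ heavy u)%:R :> R.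
  rewrite exchange_edges -sum_edge_const; apply: ler_sum => u _.
  apply: ler_sum => v _; case: (heavy u) => /=; first by rewrite mulr0.
  by rewrite mulr1 lern1 leq_b1.
have tot : \sum_u (deg e u)%:R * (heavy u)%:R +
    \sum_u (deg e u)%:R * (~~ heavy u)%:R = #|dedges e|%:R :> R.
  rewrite -big_split card_dedges natr_sum/=; apply: eq_bigr => u _.
  by case: (heavy u); rewrite /= ?mulr0 ?mulr1 ?addr0 ?add0r.
have split : \sum_u \sum_(v | e u v) (heavy u)%:R * (heavy v)%:R +
    \sum_u \sum_(v | e u v) (heavy u)%:R * (~~ heavy v)%:R =
    \sum_u (deg e u)%:R * (heavy u)%:R :> R.
  rewrite -big_split/= -sum_edge_const; apply: eq_bigr => u _.
  rewrite -big_split/=; apply: eq_bigr => v _; rewrite -mulrDr.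
  by case: (heavy v); rewrite /= ?addr0 ?add0r mulr1.
lra.
Qed.

Definition edge_prob ell (x : V * V) : R :=
  (e x.1 x.2)%:R *
  ((ell%:R * (#|V|%:R * th%:R))^-1 * (1 - unreached ell.-1 x.1)).

Lemma sum_edges (g : V * V -> R) :
  \sum_x (e x.1 x.2)%:R * g x = \sum_u \sum_(v | e u v) g (u, v).
Proof.
transitivity (\sum_u \sum_v (e u v)%:R * g (u, v)).
  by rewrite pair_bigA; apply: eq_bigr => -[].
apply: eq_bigr => u _; rewrite [RHS]big_mkcond/=; apply: eq_bigr => v _.
by case: (e u v); rewrite ?mul1r ?mul0r.
Qed.

Lemma attempts_runs ell : (0 < #|V|)%N -> (0 < ell)%N ->
  runs e nb (RandInt ell (fun k => sampling_attempt V th k))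
    (fun f => f None + \sum_x edge_prob ell x * (f (Some x) - f None)) 20.
Proof.
move=> V0 ell0; have ellR : ell%:R != 0 :> R by rewrite pnatr_eq0 -lt0n.
apply: runs_weaken.
- apply: (@runs_int _ _ _ _ _ _ _ _ (fun=> 19)) => // k _.
  exact: sampling_attempt_runs.
- move=> f /=; set g := fun x => f (Some x) - f None.
  rewrite big_split/= big_const_nat iter_addr_0 subSS subn0.
  rewrite -[f None *+ _]mulr_natl mulrDr mulKf//; congr (_ + _).
  under [RHS]eq_bigr => x _ do rewrite /edge_prob -mulrA.
  rewrite sum_edges big_add1/= big_mkord.
  (* An attempt of length k + 1 makes k rounds from a light start, encoded by [reach 0]. *)
  under [X in _ * X = _]eq_bigr => k _ do rewrite (walk_reach k 0 g).
  rewrite -mulr_sumr mulrA -invfM exchange_big mulr_sumr; apply: eq_bigr => u _.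
  rewrite exchange_big mulr_sumr; apply: eq_bigr => v _ /=.
  by rewrite /unreached prednK// opprB subrKC -mulr_suml mulrA.
- rewrite big_const_nat iter_addr_0 subSS subn0 -[19 *+ _]mulr_natl.
  by rewrite mulKf.
Qed.

(** Up to the factor common to all edges, the mass lost by bounding the walk lengths by [ell]. *)
Definition missed ell : R := \sum_u (deg e u)%:R * unreached ell.-1 u.

Lemma sum_edge_prob ell : \sum_x edge_prob ell x =
  (ell%:R * (#|V|%:R * th%:R))^-1 * (#|dedges e|%:R - missed ell).
Proof.
rewrite sum_edges /= sum_edge_const card_dedges natr_sum -sumrB mulr_sumr.
by apply: eq_bigr => u _ /=; rewrite mulrCA mulrBr mulr1.
Qed.

Lemma edge_prob_ge0 ell x : 0 <= edge_prob ell x.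
Proof.
rewrite !mulr_ge0 ?ler0n ?invr_ge0 ?mulr_ge0 ?ler0n// subr_ge0.
have /andP[_ /le_trans] := unreached_bound ell.-1 x.1; apply.
have h1 : (2^-1 : R) ^+ ell.-1 <= 1 by apply: exprn_ile1; lra.
by case: (heavy _); rewrite ?mul1r ?mul0r ?ler01.
Qed.

Lemma missed_bound ell :
  0 <= missed ell <= 2 / 3 * #|dedges e|%:R * 2^-1 ^+ ell.-1.
Proof.
apply/andP; split.
  apply: sumr_ge0 => u _; rewrite mulr_ge0//.
  by case/andP: (unreached_bound ell.-1 u).
apply: (@le_trans _ _
    ((\sum_u (deg e u)%:R * (heavy u)%:R) * 2^-1 ^+ ell.-1)).
  rewrite mulr_suml; apply: ler_sum => u _; rewrite -mulrA ler_wpM2l//.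
  by case/andP: (unreached_bound ell.-1 u).
by rewrite ler_wpM2r ?exprn_ge0 ?invr_ge0//; have := heavy_edges_le; lra.
Qed.

(** * Success probability and pointwise closeness *)

Section Accuracy.
Variables (eps : R) (ell : nat).
Hypotheses (eps_le : eps <= 2^-1) (ell_ge : 2^-1 ^+ ell.-1 <= eps).
Hypotheses (edges_gt0 : (0 < #|dedges e|)%N).
Hypotheses (ell_gt0 : (0 < ell)%N) (V_gt0 : (0 < #|V|)%N).

Let m_gt0 : 0 < #|dedges e|%:R :> R.
Proof. by rewrite ltr0n. Qed.

Let factor_gt0 : 0 < ell%:R * (#|V|%:R * th%:R) :> R.
Proof. by rewrite !mulr_gt0// ltr0n. Qed.

Lemma missed_le : missed ell <= 2 / 3 * eps * #|dedges e|%:R.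
Proof.
have /andP[_ /le_trans] := missed_bound ell; apply.
by have := ler_wpM2l (ltW m_gt0) ell_ge; lra.
Qed.

(** As eps <= 1/2, [missed_le] loses at most a third of the edges. *)
Lemma sum_edge_prob_ge :
  2 / 3 * #|dedges e|%:R / (ell%:R * (#|V|%:R * th%:R)) <=
  \sum_x edge_prob ell x.
Proof.
rewrite sum_edge_prob mulrC ler_wpM2l ?invr_ge0 ?(ltW factor_gt0)//.
by have := missed_le; have := ler_wpM2r (ltW m_gt0) eps_le; lra.
Qed.

Lemma edge_prob_close :
  pointwise_close eps (fun x => edge_prob ell x / \sum_y edge_prob ell y)
    (uniform_on R (dedges e)).
Proof.
move=> [u v]; rewrite sum_edge_prob /edge_prob /uniform_on inE/=.
case: (e u v); last by rewrite !mul0r mulr0 subrr normr0.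
rewrite mul1r -mulf_div divff ?invr_eq0 ?gt_eqF// mul1r.
have /andP[s0 s_le] := unreached_bound ell.-1 u.
have {}s_le : unreached ell.-1 u <= eps.
  apply: le_trans s_le _; apply: le_trans ell_ge.
  by case: (heavy u); rewrite ?mul1r ?mul0r// exprn_ge0// invr_ge0.
have /andP[D0 _] := missed_bound ell; have Dle := missed_le.
move: m_gt0 s0 s_le D0 Dle; set s := unreached _ _; set D := missed _.
set m := _%:R => m0 s0 s_le D0 Dle.
have em := ler_wpM2r (ltW m0) eps_le; have mD : 0 < m - D by lra.
have -> : (1 - s) / (m - D) - m^-1 = ((1 - s) * m - (m - D)) / (m - D) / m.
  by field; rewrite !gt_eqF.
rewrite normrM [`|m^-1|]gtr0_norm ?invr_gt0// ler_wpM2r ?invr_ge0 ?(ltW m0)//.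
rewrite normrM [`|(m - D)^-1|]gtr0_norm ?invr_gt0// ler_pdivrMr//.
(* The numerator is D - s m. Above, D <= eps (m - D) follows from D <= 2/3 eps m and 1 + eps <= 3/2;
   below, s <= eps <= 1 and 0 <= D suffice. *)
rewrite ler_norml; apply/andP; split; nra.
Qed.

End Accuracy.

End Graph.

(** * Estimates for the threshold and the number of levels *)

Section ThresholdAndLevels.
Variable R : realType.

Lemma natceil_bounds (x : R) : 0 <= x ->
  x <= `|Num.ceil x|%N%:R < x + 1.
Proof.
move=> x0; have c0 : 0 <= Num.ceil x by rewrite ceil_ge0 (lt_le_trans _ x0).
rewrite natr_absz ger0_norm// ceil_ge/=.
by have := ceilB1_lt x; rewrite intrB; lra.
Qed.

Lemma theta_sqr m : (2 * m <= theta R m ^ 2)%N.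
Proof.
have /andP[+ _] := natceil_bounds (sqrtr_ge0 (2 * m%:R)).
rewrite -/(theta R m) -(@ler_pXn2r _ 2) ?nnegrE ?sqrtr_ge0//.
by rewrite sqr_sqrtr ?mulr_ge0// -natrX -natrM ler_nat.
Qed.

Lemma theta_le m : (0 < m)%N -> (theta R m)%:R <= 3 * Num.sqrt m%:R :> R.
Proof.
move=> m0; have /andP[_ /ltW/le_trans] := natceil_bounds (sqrtr_ge0 (2 * m%:R)).
apply; have m1 : 1 <= Num.sqrt m%:R :> R.
  by rewrite -[leLHS]sqrtr1 ler_sqrt// ler1n.
have : Num.sqrt (2 * m%:R) <= 2 * Num.sqrt m%:R :> R.
  rewrite sqrtrM// ler_wpM2r ?sqrtr_ge0//.
  by rewrite -[leRHS]ger0_norm// -sqrtr_sqr ler_sqrt ?expr2//; lra.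
by lra.
Qed.

Lemma num_levels_pow (eps : R) : 0 < eps -> eps <= 2^-1 ->
  2^-1 ^+ (num_levels eps).-1 <= eps.
Proof.
move=> e0 e1; have ln2 : 0 < ln 2 :> R by rewrite ln_gt0// ltr1n.
have e1' : 2 <= eps^-1 by rewrite -[leLHS]invrK lef_pV2 ?posrE ?invr_gt0.
have : 0 <= ln eps^-1 / ln 2.
  by rewrite divr_ge0 ?(ltW ln2)// ln_ge0//; lra.
move=> /natceil_bounds/andP[+ _]; rewrite ler_pdivrMr// mulrC mulr_natr.
rewrite -lnXn// ler_ln ?posrE ?invr_gt0 ?exprn_gt0// => h.
by rewrite exprVn -[leRHS]invrK lef_pV2 ?posrE ?invr_gt0 ?exprn_gt0.
Qed.

(** With L the binary logarithm of 1 / eps, the ceiling plus one is below L + 2, and L >= 1 because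
    eps <= 1/2. *)
Lemma num_levels_le (eps : R) : 0 < eps -> eps <= 2^-1 ->
  (num_levels eps)%:R <= 3 * (ln eps^-1 / ln 2) :> R.
Proof.
move=> e0 e1; have ln2 : 0 < ln 2 :> R by rewrite ln_gt0// ltr1n.
have e1' : 2 <= eps^-1 by rewrite -[leLHS]invrK lef_pV2 ?posrE ?invr_gt0.
have L1 : 1 <= ln eps^-1 / ln 2.
  by rewrite ler_pdivlMr// mul1r ler_ln ?posrE ?invr_gt0.
have /andP[_] := natceil_bounds (le_trans ler01 L1).
by rewrite /num_levels -natr1; lra.
Qed.

End ThresholdAndLevels.

(** * Assembling the running time and the output distribution *)

Theorem theorem6 (R : realType) :
  exists C : R, 0 < C /\
    forall (eps : R) (V : finType) (e : rel V) (nb : V -> seq V),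
      0 < eps -> eps <= 2^-1 ->
      simple_graph e -> neighbor_ordering e nb ->
      (0 < #|dedges e|)%N ->
      let n := #|V| in
      let m := #|dedges e| in
      let alg := sample_edge V m eps in
      (expected_time R e nb alg <=
         (C * (n%:R / Num.sqrt m%:R * ln eps^-1))%:E)%E /\
      is_distr (output_prob R e nb alg) /\
      pointwise_close eps (output_prob R e nb alg) (uniform_on R (dedges e)).
Proof.
(* 63/2 is the 20 + 1 units per attempt over the 2/3 of the success bound; 9 is the product of the
   factors 3 in [th_le] and [ell_le]; 7 counts the initial operations. *)
have arith (T K : R) : 1 <= K -> T <= 63 / 2 * (9 * K) -> 7 + T <= 300 * K.
  lra.
have ln2_gt0 : 0 < ln 2 :> R by rewrite ln_gt0// ltr1n.
(* Dividing by ln 2 converts the natural logarithm to the binary one. *)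
exists (300 / ln 2); split; first by rewrite divr_gt0 ?ltr0n.
move=> eps V e nb eps_gt0 eps_le [e_sym _] nbP m_gt0 n m alg.
set th := theta R m; set ell := num_levels eps.
have th_ge : (2 * #|dedges e| <= th ^ 2)%N := theta_sqr R m.
have th_gt0 : (0 < th)%N.
  rewrite lt0n; apply: contraTneq th_ge => ->.
  by rewrite -ltnNge exp0n// muln_gt0.
have ell_gt0 : (0 < ell)%N by [].
have V_gt0 : (0 < #|V|)%N.
  by case/card_gt0P: m_gt0 => -[u v] _; apply/card_gt0P; exists u.
have ell_pow : 2^-1 ^+ ell.-1 <= eps := num_levels_pow eps_gt0 eps_le.
have mR : 0 < #|dedges e|%:R :> R by rewrite ltr0n.
have factor_gt0 : 0 < ell%:R * (#|V|%:R * th%:R) :> R.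
  by rewrite !mulr_gt0// ltr0n.
have sum_ge := sum_edge_prob_ge e_sym th_gt0 th_ge eps_le ell_pow m_gt0
  ell_gt0 V_gt0.
have sum_gt0 : 0 < \sum_x edge_prob R e th ell x.
  by apply: lt_le_trans sum_ge; rewrite divr_gt0// mulr_gt0// divr_gt0.
have prob_ge0 := @edge_prob_ge0 R V e th th_gt0 th_ge ell.
have [time_le outE] := repeat_until_successP
  (attempts_runs R e_sym nbP th_gt0 th_ge V_gt0 ell_gt0) prob_ge0 sum_gt0 7.
have {}outE : output_prob R e nb alg = _ := funext outE.
rewrite outE; split; last split.
- apply: le_trans time_le _; rewrite lee_fin.
  set M := Num.sqrt m%:R; set L := ln eps^-1 / ln 2.
  have M_sqr : M ^+ 2 = m%:R by rewrite sqr_sqrtr.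
  have M_gt0 : 0 < M by rewrite sqrtr_gt0.
  (* Edges are pairs of vertices, so m <= n^2. Thus n / sqrt m >= 1, and the main term absorbs the 7
     initial operations. *)
  have n_ge : M <= n%:R.
    rewrite -(@ler_pXn2r _ 2) ?nnegrE ?(ltW M_gt0)// M_sqr -natrX ler_nat.
    by rewrite (leq_trans (max_card _))// card_prod mulnn.
  have th_le : th%:R <= 3 * M := theta_le R m_gt0.
  have ell_le : ell%:R <= 3 * L := num_levels_le eps_gt0 eps_le.
  have L_ge : 1 <= L.
    rewrite ler_pdivlMr// mul1r ler_ln ?posrE ?invr_gt0//.
    by rewrite -[leLHS]invrK lef_pV2 ?posrE ?invr_gt0.
  have -> : 300 / ln 2 * (n%:R / M * ln eps^-1) = 300 * (n%:R / M * L).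
    by rewrite /L; ring.
  have nM : 1 <= n%:R / M by rewrite ler_pdivlMr// mul1r.
  have time_attempts : (20 + 1) / \sum_x edge_prob R e th ell x <=
      63 / 2 * (ell%:R * (n%:R * th%:R)) / M ^+ 2.
    rewrite ler_pdivrMr//; apply: le_trans (ler_wpM2l _ sum_ge).
      rewrite M_sqr -/m -/n le_eqVlt; apply/orP; left; apply/eqP.
      by field; rewrite ?gt_eqF//= ltr0n.
    by rewrite !mulr_ge0 ?invr_ge0 ?sqr_ge0.
  have bound : ell%:R * (n%:R * th%:R) / M ^+ 2 <= 9 * (n%:R / M * L).
    apply: (@le_trans _ _ (3 * L * (n%:R * (3 * M)) / M ^+ 2)); last first.
      by rewrite le_eqVlt; apply/orP; left; apply/eqP; field; rewrite gt_eqF.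
    rewrite ler_wpM2r ?invr_ge0 ?sqr_ge0// ler_pM ?mulr_ge0//.
    by rewrite ler_wpM2l.
  have seven : 1 <= n%:R / M * L.
    by rewrite -[leLHS]mulr1 ler_pM.
  have {time_attempts} : (20 + 1) / \sum_x edge_prob R e th ell x <=
      63 / 2 * (9 * (n%:R / M * L)).
    by apply: le_trans time_attempts _; rewrite -mulrA ler_wpM2l// divr_ge0.
  exact: arith.
- split=> [x|]; first by rewrite divr_ge0 ?prob_ge0 ?ltW.
  by rewrite -mulr_suml mulfV// gt_eqF.
- exact: edge_prob_close.
Qed.
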